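(* If a topological vector space $E$ has the property $(K)$, then it has the property $(MK)$.
   Context: A null sequence in a topological vector space (tvs) is a sequence converging to $0$. A null sequence $(x_n)_n$ in a tvs $E$ is a $K$-sequence if every subsequence of $(x_n)_n$ contains a subsequence $(y_n)_n$ such that the series $\sum_n y_n$ converges in $E$. A sequence $(x_n)_n$ in $E$ is Mackey null if there exists an increasing unbounded sequence $(a_n)_n$ of positive numbers such that $a_n x_n\to 0$ in $E$. $E$ has the property $(K)$ if every null sequence in $E$ is a $K$-sequence; $E$ has the property $(MK)$ if every Mackey null sequence in $E$ is a $K$-sequence. *)

(* Defs.v *)
From mathcomp Require Import all_boot all_order all_algebra.
From mathcomp Require Import all_classical all_reals all_analysis.

Set Implicit Arguments.
Unset Strict Implicit.
Unset Printing Implicit Defensive.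

Import Order.TTheory GRing.Theory Num.Theory.

Local Open Scope classical_set_scope.
Local Open Scope ring_scope.

(* A topological vector space over K is a [topologicalLmodType K]: addition and
   scaling are jointly continuous.  (The library's [tvsType] would add local
   convexity.)  Any [numFieldType] K is allowed, in particular the real numbers
   and the complex numbers. *)

Definition null_seq (K : numFieldType) (E : topologicalLmodType K)
    (x : nat -> E) : Prop :=
  x @ \oo --> (0 : E).

(* [increasing_seq] is strict monotonicity, so [y \o s] with
   [increasing_seq s] is a subsequence of [y]. *)
Definition K_seq (K : numFieldType) (E : topologicalLmodType K)
    (x : nat -> E) : Prop :=
  null_seq x /\
  forall s : nat -> nat, increasing_seq s ->
    exists2 t : nat -> nat, increasing_seq t &
      exists l : E, series (x \o s \o t) @ \oo --> l.

(* The order of K = C is partial, but [0 < a n] forces [a n] to be real, and an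
   upper bound in K of positive reals is itself real; so the conditions on [a]
   say that it is an increasing unbounded sequence of positive real numbers. *)
Definition Mackey_null_seq (K : numFieldType) (E : topologicalLmodType K)
    (x : nat -> E) : Prop :=
  exists a : nat -> K,
    [/\ forall n, 0 < a n,
        increasing_seq a,
        ~ has_ubound (range a)
      & null_seq (fun n => a n *: x n)].

Definition property_K (K : numFieldType) (E : topologicalLmodType K) : Prop :=
  forall x : nat -> E, null_seq x -> K_seq x.

Definition property_MK (K : numFieldType) (E : topologicalLmodType K) : Prop :=
  forall x : nat -> E, Mackey_null_seq x -> K_seq x.

(* Main.v *)
Require Import Defs.
From mathcomp Require Import all_boot all_order all_algebra.
From mathcomp Require Import all_classical all_reals all_analysis.

(** Every Mackey null sequence is null, so property (K) applies to it directly.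
    Indeed, if [a n *: x n] tends to 0 with [a] positive, increasing and
    unbounded, then [a n]^-1 tends to 0 in the scalars ([cvg_inv_unbounded]),
    and joint continuity of scaling at (0, 0) gives
    [x n = (a n)^-1 *: (a n *: x n) --> 0 *: 0 = 0] ([Mackey_null_seq_null]). *)

Import Order.TTheory GRing.Theory Num.Theory.
Import numFieldNormedType.Exports.

Local Open Scope classical_set_scope.
Local Open Scope ring_scope.

(** Unboundedness is tested against [e^-1], an element of the field itself, so
    the argument covers non-archimedean scalars.  The order may be partial, as
    on complex numbers, but positive elements are always comparable: a term
    that is not below [e^-1] is above it, and monotonicity carries this to all
    later terms. *)
Lemma cvg_inv_unbounded (K : numFieldType) (a : nat -> K) :
  (forall n, 0 < a n) -> nondecreasing_seq a -> ~ has_ubound (range a) ->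
  (fun n => (a n)^-1) @ \oo --> (0 : K).
Proof.
move=> a_gt0 a_nd a_unb; apply/cvgr0Pnorm_lt => e e_gt0.
have [N ltN] : exists N, e^-1 < a N.
  apply: contrapT => /forallNP noN; apply: a_unb; exists e^-1 => _ [n _ <-].
  have cmp : a n >=< e^-1 by rewrite real_comparable// gtr0_real// invr_gt0.
  by rewrite comparable_leNgt//; apply/negP/noN.
exists N => // n /= leNn.
by rewrite gtr0_norm ?invr_gt0// invf_plt ?posrE// (lt_le_trans ltN)// a_nd.
Qed.

Lemma Mackey_null_seq_null (K : numFieldType) (E : topologicalLmodType K)
    (x : nat -> E) : Mackey_null_seq x -> null_seq x.
Proof.
move=> [a [a_gt0 a_inc a_unb ax0]].
have a_nd : nondecreasing_seq a by move=> m n; rewrite a_inc.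
have inva0 := cvg_inv_unbounded _ _ a_gt0 a_nd a_unb.
have -> : x = fun n => (a n)^-1 *: (a n *: x n).
  by apply/funext => n; rewrite scalerA mulVf ?scale1r// gt_eqF.
rewrite /null_seq -[X in _ --> X](scale0r (0 : E)).
exact: (cvg_comp2 inva0 ax0 (@scale_continuous K E (0, 0))).
Qed.

Theorem proposition2p1 (K : numFieldType) (E : topologicalLmodType K) :
  property_K E -> property_MK E.
Proof. by move=> KE x /Mackey_null_seq_null; exact: KE. Qed.
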